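(* Let $X=X_1\times X_2$ be as in the context. For $j=1,2$ let $-\mathbf{A}_j:\mathrm{dom}(\mathbf{A}_j)\subset X_j\to X_j$ be generators of strongly continuous contraction semigroups, and let $\mathbf{B}_1:X_2\to X_1$, $\mathbf{B}_2:X_1\to X_2$ be bounded. Assume moreover that $\mathcal{A}$ and $\mathcal{C}$ are boundedly invertible. Then there is a constant $C=C(\|\mathbf{B}_2\|,\|\mathbf{B}_1\|,\|\mathbf{A}_1^{-1}\|,\|\mathbf{A}_2^{-1}\|)>0$ such that for all $t>0$ and $n\ge1$, \[ \|\mathcal{T}(t/n)^n-\mathrm{e}^{-t\mathcal{C}}\|_{\mathcal{A}}\le \frac{C}{n}\,t^2\,\mathrm{e}^{2t(\|\mathbf{B}_1\|+\|\mathbf{B}_2\|)}, \] where for a bounded operator $\mathcal{K}:X\to X$, $\|\mathcal{K}\|_{\mathcal{A}}:=\sup\{\|\mathcal{K}f\|: f\in\mathrm{dom}(\mathcal{A}),\ \|\mathcal{A}f\|\le1\}=\|\mathcal{K}\mathcal{A}^{-1}\|$.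
   Context: $X=X_1\times X_2$ for Banach spaces $X_1,X_2$, with norm $\|(x,y)\|^2=\|x\|_{X_1}^2+\|y\|_{X_2}^2$. For $\tau\ge0$ set $\mathbf{E}_j(\tau)=\mathrm{e}^{-\tau\mathbf{A}_j}$ and $\mathbf{X}_j(\tau)=\int_0^\tau \mathrm{e}^{-\sigma\mathbf{A}_j}\,\mathrm{d}\sigma\,\mathbf{B}_j$ (strong integral). The split-step operator on $X$ is \[ \mathcal{T}(\tau)=\begin{pmatrix}\mathbf{E}_1(\tau) & \mathbf{X}_1(\tau)\\ \mathbf{X}_2(\tau)\mathbf{E}_1(\tau) & \mathbf{X}_2(\tau)\mathbf{X}_1(\tau)+\mathbf{E}_2(\tau)\end{pmatrix}. \] $\mathcal{A}=\mathrm{diag}(\mathbf{A}_1,\mathbf{A}_2)$ on $\mathrm{dom}(\mathcal{A})=\mathrm{dom}(\mathbf{A}_1)\times\mathrm{dom}(\mathbf{A}_2)$; $\mathcal{B}=\begin{pmatrix}0&\mathbf{B}_1\\\mathbf{B}_2&0\end{pmatrix}$; $\mathcal{C}=\mathcal{A}-\mathcal{B}$ with $\mathrm{dom}(\mathcal{C})=\mathrm{dom}(\mathcal{A})$, so $-\mathcal{C}$ generates the strongly continuous semigroup $(\mathrm{e}^{-t\mathcal{C}})_{t\ge0}$. *)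

(* Defs.v *)
From HB Require Import structures.
From mathcomp Require Import all_boot all_order all_algebra.
From mathcomp Require Import all_classical all_reals all_analysis.
Set Implicit Arguments. Unset Strict Implicit. Unset Printing Implicit Defensive.
Import Order.TTheory GRing.Theory Num.Theory.
Import numFieldNormedType.Exports.
Local Open Scope classical_set_scope.
Local Open Scope ring_scope.

Section Defs.
Variable R : realType.

Definition bounded_linear (V W : normedModType R) (B : V -> W) : Prop :=
  linear B /\ exists M : R, forall x, `|B x| <= M * `|x|.

Definition opnorm (V W : normedModType R) (B : V -> W) : R :=
  sup [set `|B x| | x in [set x : V | `|x| <= 1]].

Definition C0_semigroup (V : normedModType R) (E : R -> V -> V) : Prop :=
  [/\ forall t, 0 <= t -> bounded_linear (E t),
      forall x, E 0 x = x,
      forall s t x, 0 <= s -> 0 <= t -> E (s + t) x = E s (E t x)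
    & forall x, E t x @[t --> 0^'+] --> x].

Definition C0_contraction_semigroup (V : normedModType R) (E : R -> V -> V) : Prop :=
  C0_semigroup E /\ forall t x, 0 <= t -> `|E t x| <= `|x|.

Definition is_generator (V : normedModType R) (E : R -> V -> V)
    (D : set V) (G : V -> V) : Prop :=
  (forall x, D x <-> cvg (h^-1 *: (E h x - x) @[h --> 0^'+])) /\
  (forall x, D x -> h^-1 *: (E h x - x) @[h --> 0^'+] --> G x).

Definition bounded_inverse (V : normedModType R) (D : set V) (A : V -> V)
    (Ainv : V -> V) : Prop :=
  [/\ forall x, D (Ainv x),
      forall x, A (Ainv x) = x,
      forall f, D f -> Ainv (A f) = f
    & bounded_linear Ainv].

(* Strong (Riemann) integral  int_0^tau E(s) v ds, as the limit of the
   uniform left Riemann sums (the integrand is continuous on [0,tau]). *)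
Definition sint (V : normedModType R) (E : R -> V -> V) (tau : R) (v : V) : V :=
  limn (fun N : nat => (tau / N.+1%:R) *:
          \sum_(k < N.+1) E (tau * k%:R / N.+1%:R) v).

Definition pnorm (X1 X2 : normedModType R) (f : X1 * X2) : R :=
  Num.sqrt (`|f.1| ^+ 2 + `|f.2| ^+ 2).

Definition split_step (X1 X2 : normedModType R)
    (E1 : R -> X1 -> X1) (E2 : R -> X2 -> X2)
    (B1 : X2 -> X1) (B2 : X1 -> X2) (tau : R) (f : X1 * X2) : X1 * X2 :=
  let X1op := fun y : X2 => sint E1 tau (B1 y) in
  let X2op := fun x : X1 => sint E2 tau (B2 x) in
  (E1 tau f.1 + X1op f.2,
   X2op (E1 tau f.1) + X2op (X1op f.2) + E2 tau f.2).

End Defs.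

(* Main.v *)
(* Each half step is a contraction semigroup with a bounded source, and since
   A_j is invertible the source integral is elementary: X_j(t) y = w - E_j(t) w
   with w = A_j^-1 B_j y.  On the domain D of A and C, s |-> S(s) f has the right
   derivative -C S(s) f, so Dini-Gronwall comparison with the E_j gives
   |S(t) f| <= e^{bt} |f| with b = |B_1| + |B_2|, and a one-step error
   O(tau^2) N(f), where N(f) = |C f| + b |f| is controlled by |A f| through
   A^-1 only.  As N(S(s) f) <= e^{bs} N(f) and the step is bounded by e^{b tau},
   telescoping T^n - S(n tau) sums n one-step errors.  All estimates are made in
   the max norm of X_1 * X_2; its equivalence with the Hilbert-sum norm costs a
   factor 2. *)
Require Import Defs.
From HB Require Import structures.
From mathcomp Require Import all_boot all_order all_algebra.
From mathcomp Require Import all_classical all_reals all_analysis.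
From mathcomp Require Import ring lra.
Set Implicit Arguments.
Unset Strict Implicit.
Unset Printing Implicit Defensive.
Import Order.TTheory GRing.Theory Num.Theory.
Import numFieldNormedType.Exports.
Local Open Scope classical_set_scope.
Local Open Scope ring_scope.

(** * Linear maps and the operator norm *)

Section LinearMaps.
Context {R : realType} {V W : normedModType R} {f : V -> W}.
Hypothesis lf : linear f.

Lemma linear_fD x y : f (x + y) = f x + f y.
Proof. by rewrite -{1}[x]scale1r lf scale1r. Qed.

Lemma linear_f0 : f 0 = 0.
Proof. by apply: (addrI (f 0)); rewrite -linear_fD !addr0. Qed.

Lemma linear_fZ a x : f (a *: x) = a *: f x.
Proof. by rewrite -[a *: x]addr0 lf linear_f0 addr0. Qed.

Lemma linear_fN x : f (- x) = - f x.
Proof. by rewrite -scaleN1r linear_fZ scaleN1r. Qed.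

Lemma linear_fB x y : f (x - y) = f x - f y.
Proof. by rewrite linear_fD linear_fN. Qed.

End LinearMaps.

Section OperatorNorm.
Context {R : realType} {V W : normedModType R} {B : V -> W}.
Hypothesis bB : bounded_linear B.

Lemma opnorm_ubound :
  has_ubound [set `|B x| | x in [set x : V | `|x| <= 1]].
Proof.
case: bB => lB [M HM]; exists (Num.max M 0) => _ [x /= x1 <-].
rewrite (le_trans (HM x))// (le_trans (y := Num.max M 0 * `|x|))//.
  by rewrite ler_wpM2r// le_max lexx.
by rewrite ler_piMr// le_max lexx orbT.
Qed.

Lemma opnorm_ge0 : 0 <= opnorm B.
Proof.
apply: (ub_le_sup opnorm_ubound); exists 0; first by rewrite /= normr0.
by rewrite (linear_f0 (proj1 bB)) normr0.
Qed.

Lemma le_opnorm x : `|B x| <= opnorm B * `|x|.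
Proof.
have [->|x0] := eqVneq x 0.
  by rewrite (linear_f0 (proj1 bB)) !normr0 mulr0.
have nx : 0 < `|x| by rewrite normr_gt0.
rewrite -ler_pdivrMr//.
apply: (ub_le_sup opnorm_ubound); exists (`|x|^-1 *: x) => /=.
  by rewrite normrZ normfV normr_id mulVf// gt_eqF.
by rewrite (linear_fZ (proj1 bB)) normrZ normfV normr_id mulrC.
Qed.

End OperatorNorm.

(** * Right-hand limits and difference quotients at 0 *)

Section RightLimits.
Context {R : realType} {V : normedModType R}.

Lemma cvg_at_right0P (f : R -> V) l :
  f h @[h --> 0^'+] --> l <->
  forall e, 0 < e -> exists2 d, 0 < d &
    forall h, 0 < h < d -> `|f h - l| <= e.
Proof.
split=> [/cvgrPdist_le fl e e0|fl].
  have [d /= d0 Hd] := fl _ e0; exists d => // h /andP[h0 hd].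
  by rewrite distrC; apply: Hd => //=; rewrite sub0r normrN gtr0_norm.
apply/cvgrPdist_le => e e0; have [d d0 Hd] := fl _ e0.
exists d => //= h /=; rewrite sub0r normrN => hd h0.
by rewrite distrC Hd// h0 -(gtr0_norm h0).
Qed.

(** Clearing the denominator turns a right derivative into a first-order expansion with remainder at
    most [e * h], the form in which later estimates add up. *)
Lemma cvg_quotientP (u : R -> V) x l :
  h^-1 *: (u h - x) @[h --> 0^'+] --> l <->
  forall e, 0 < e -> exists2 d, 0 < d &
    forall h, 0 < h < d -> `|u h - x - h *: l| <= e * h.
Proof.
have E h : 0 < h -> `|u h - x - h *: l| = `|h^-1 *: (u h - x) - l| * h.
  move=> h0; rewrite -[X in _ = _ * X](gtr0_norm h0) mulrC -normrZ.
  by rewrite scalerBr scalerA divff ?scale1r// gt_eqF.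
rewrite cvg_at_right0P; split=> H e e0; have [d d0 Hd] := H _ e0;
  exists d => // h /[dup] /andP[h0 _] /Hd.
  by rewrite E// => ?; rewrite ler_wpM2r// ltW.
by rewrite E// ler_pM2r.
Qed.

End RightLimits.

(** * A Gronwall inequality for one-sided Dini bounds *)

Section Gronwall.
Context {R : realType}.
Implicit Types (f phi : R -> R) (T : R).

(** Let [m] be the supremum of the times up to which [f] stays nonnegative. The left condition
    forbids a downward jump at [m], and the right condition pushes nonnegativity beyond [m] unless
    [m = T]. *)
Lemma ge0_continuation f T : 0 <= T -> 0 <= f 0 ->
  (forall t, 0 < t <= T -> forall e, 0 < e -> exists2 d, 0 < d &
     forall s, t - d < s < t -> 0 <= s -> f s <= f t + e) ->
  (forall t, 0 <= t < T -> 0 <= f t -> exists2 d, 0 < d &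
     forall h, 0 < h < d -> 0 <= f (t + h)) ->
  0 <= f T.
Proof.
move=> T0 f0 fleft fright.
pose Z := [set t | 0 <= t <= T /\ forall s, 0 <= s <= t -> 0 <= f s].
have Z0 : Z 0.
  split; first by rewrite lexx.
  by move=> s /andP[s0 s1]; rewrite (_ : s = 0)//; apply/eqP; rewrite eq_le s1.
have ZT : has_ubound Z by exists T => t [/andP[_ ?]].
have hZ : has_sup Z by split => //; exists 0.
set m := sup Z.
have m0 : 0 <= m by exact: (ub_le_sup ZT).
have mT : m <= T by apply: ge_sup => [|t [/andP[_ ?]]//]; exists 0.
have fm s : 0 <= s < m -> 0 <= f s.
  move=> /andP[s0 sm].
  have [z [_ Hz] mz] := @sup_adherent R Z (m - s) ltac:(by rewrite subr_gt0) hZ.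
  by apply: Hz; rewrite s0 ltW//; move: mz; rewrite -/m; lra.
have fmm : 0 <= f m.
  have [m00|mn0] := eqVneq m 0; first by rewrite m00.
  have mp : 0 < m by rewrite lt_neqAle eq_sym mn0.
  rewrite leNgt; apply/negP => fneg.
  have [d d0 Hd] := fleft m ltac:(by rewrite mp) (- f m / 2) ltac:(lra).
  pose s := Num.max 0 (m - d / 2).
  have sm : s < m by rewrite /s gt_max mp /=; lra.
  have s0 : 0 <= s by rewrite /s le_max lexx.
  have sd : m - d < s by rewrite /s lt_max; apply/orP; right; lra.
  have := Hd s ltac:(by rewrite sd) s0.
  by have := fm s ltac:(by rewrite s0); lra.
have fle s : 0 <= s <= m -> 0 <= f s.
  move=> /andP[s0]; rewrite le_eqVlt => /predU1P[->//|sm].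
  by apply: fm; rewrite s0.
have [<-//|mnT] := eqVneq m T.
have mltT : m < T by rewrite lt_neqAle mnT.
have [d d0 Hd] := fright m ltac:(by rewrite m0) fmm.
pose h := Num.min (d / 2) (T - m).
have h0 : 0 < h by rewrite /h lt_min; apply/andP; split; lra.
have hd : h < d by rewrite /h gt_min; apply/orP; left; lra.
have hT : h <= T - m by rewrite /h ge_min lexx orbT.
have : Z (m + h).
  split; first by apply/andP; split; lra.
  move=> s /andP[s0 smh]; have [sm|ms] := leP s m; first by rewrite fle// s0.
  have := Hd (s - m) ltac:(by apply/andP; split; lra).
  by rewrite (_ : m + (s - m) = s)//; ring.
by move=> /(ub_le_sup ZT); rewrite -/m; lra.
Qed.

(** Continuation is applied to [expR (b * t) * (phi 0 + (m + e) * t) - phi t]; the slack [e] absorbs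
    the remainder of the right increment and is then sent to 0. *)
Lemma dini_gronwall phi b m T : 0 <= T -> 0 <= b -> 0 <= m -> 0 <= phi 0 ->
  (forall t, 0 < t <= T -> forall e, 0 < e -> exists2 d, 0 < d &
     forall s, t - d < s < t -> 0 <= s -> phi t <= phi s + e) ->
  (forall t, 0 <= t < T -> forall e, 0 < e -> exists2 d, 0 < d &
     forall h, 0 < h < d -> phi (t + h) <= (1 + b * h) * phi t + (m + e) * h) ->
  phi T <= expR (b * T) * (phi 0 + m * T).
Proof.
move=> T0 b0 m0 phi0 phileft phiright.
suff H e : 0 < e -> phi T <= expR (b * T) * (phi 0 + (m + e) * T).
  apply/ler_addgt0Pr => e e0.
  set X := expR (b * T) in H *.
  have X0 : 0 < X by exact: expR_gt0.
  have T1 : 0 < T + 1 by lra.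
  have XT : 0 < X * (T + 1) by rewrite mulr_gt0.
  (* This slack costs [e * (T / (T + 1))], at most [e]; the [+ 1] covers [T = 0]. *)
  apply: (le_trans (H (e / (X * (T + 1))) (divr_gt0 e0 XT))).
  have -> : X * (phi 0 + (m + e / (X * (T + 1))) * T)
      = X * (phi 0 + m * T) + e * (T / (T + 1)).
    by field; rewrite !gt_eqF.
  by rewrite lerD2l ler_piMr ?(ltW e0)// ler_pdivrMr; lra.
move=> e0.
suff : 0 <= expR (b * T) * (phi 0 + (m + e) * T) - phi T by rewrite subr_ge0.
apply: (@ge0_continuation
  (fun t => expR (b * t) * (phi 0 + (m + e) * t) - phi t)) => //.
- by rewrite !mulr0 expR0 mul1r addr0 subrr.
- move=> t tT k k0; have [d d0 Hd] := phileft t tT k k0.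
  exists d => // s sd s0; have H := Hd s sd s0; move: sd => /andP[_ st].
  have : expR (b * s) * (phi 0 + (m + e) * s)
      <= expR (b * t) * (phi 0 + (m + e) * t).
    apply: ler_pM; rewrite ?expR_ge0//.
    - by rewrite addr_ge0// mulr_ge0//; lra.
    - by rewrite ler_expR ler_wpM2l// ltW.
    - by rewrite lerD2l ler_wpM2l//; lra.
  by lra.
- move=> t tT Ht; have [d d0 Hd] := phiright t tT e e0.
  exists d => // h hd; have H := Hd h hd; move: hd tT => /andP[h0 _] /andP[t0 _].
  rewrite subr_ge0 (le_trans H)// [b * (t + h)]mulrDr expRD.
  set X := expR (b * t); set Y := expR (b * h).
  have hY : 1 + b * h <= Y by exact: expR_ge1Dx.
  have bh : 0 <= b * h by rewrite mulr_ge0// ltW.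
  have X1 : 1 <= X by rewrite -expR0 ler_expR mulr_ge0.
  have P0 : 0 <= phi 0 + (m + e) * t by rewrite addr_ge0// mulr_ge0//; lra.
  move: Ht; rewrite subr_ge0 -/X => Ht.
  (* At [t + h] the comparison function is its old value times [Y >= 1 + b * h], plus the new source
     times [X * Y >= 1]. *)
  rewrite (_ : X * Y * _ = Y * (X * (phi 0 + (m + e) * t))
                           + X * Y * ((m + e) * h)); last by ring.
  apply: lerD.
    apply: (le_trans (y := (1 + b * h) * (X * (phi 0 + (m + e) * t)))).
      by rewrite ler_wpM2l//; lra.
    by rewrite ler_wpM2r// mulr_ge0//; lra.
  rewrite ler_peMl//; first by rewrite mulr_ge0//; lra.
  by rewrite -[1]mulr1 ler_pM//; lra.
Qed.
End Gronwall.

Lemma subrACA (V : zmodType) (x y z t : V) : x - y - (z - t) = x - z - (y - t).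
Proof. by rewrite !opprD addrACA. Qed.

(** One step of a perturbed orbit: [b] is the present state, [a] the next one, [c] the unperturbed
    step from [b], [p] and [q] the increments due to generator and source, [g] a reference point.
    The generator increment [p], an unbounded term, cancels. *)
Lemma increment_norm_le {R : realType} {V : normedModType R}
    (a b c g p q : V) (e1 e2 : R) :
  `|a - b - (p + q)| <= e1 -> `|c - b - p| <= e2 ->
  `|a - g| <= `|c - g| + `|q| + (e1 + e2).
Proof.
move=> H1 H2.
have -> : a - g = c - g + q + (a - b - (p + q) - (c - b - p)).
  rewrite [a - b - _ - _]subrACA [a - b - _]subrACA subrr subr0.
  by rewrite [p + q]addrC addrK addrACA subrr addr0 [RHS]addrC addrA subrK.
rewrite (le_trans (ler_normD _ _))// lerD ?ler_normD//.
by rewrite (le_trans (ler_normB _ _))// lerD.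
Qed.

Lemma bounded_linear_pos {R : realType} {V W : normedModType R} {B : V -> W} :
  bounded_linear B -> exists2 M, 0 < M & forall x, `|B x| <= M * `|x|.
Proof.
move=> bB; exists (opnorm B + 1); first by rewrite ltr_wpDl// opnorm_ge0.
by move=> x; rewrite (le_trans (le_opnorm bB x))// ler_wpM2r// lerDl.
Qed.

(** * Generators and orbits of strongly continuous semigroups *)

Section Generator.
Context {R : realType} {V : normedModType R} {E : R -> V -> V}
  {D : set V} {G : V -> V}.
Hypothesis sgE : C0_semigroup E.
Hypothesis genE : is_generator E D G.

Lemma semigroup_linear t : 0 <= t -> linear (E t).
Proof. by case: sgE => H _ _ _ /H []. Qed.

Lemma generatorP x l :
  (forall e, 0 < e -> exists2 d, 0 < d &
    forall h, 0 < h < d -> `|E h x - x - h *: l| <= e * h) ->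
  D x /\ G x = l.
Proof.
move=> /(cvg_quotientP (fun h => E h x)) xl.
have Dx : D x by apply/genE.1/cvg_ex; exists l.
split=> //; exact: (cvg_unique _ (genE.2 x Dx) xl).
Qed.

Lemma generator_quotient x : D x ->
  forall e, 0 < e -> exists2 d, 0 < d &
    forall h, 0 < h < d -> `|E h x - x - h *: G x| <= e * h.
Proof. by move=> Dx; apply/cvg_quotientP; exact: genE.2. Qed.

Lemma generatorB x y : D x -> D y -> D (x - y) /\ G (x - y) = G x - G y.
Proof.
move=> Dx Dy; apply: generatorP => e e0.
have e2 : 0 < e / 2 by rewrite divr_gt0.
have [d1 d10 H1] := generator_quotient Dx e2.
have [d2 d20 H2] := generator_quotient Dy e2.
exists (Num.min d1 d2) => [|h]; first by rewrite lt_min d10.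
rewrite lt_min => /and3P[h0 h1 h2].
rewrite (linear_fB (semigroup_linear (ltW h0))) scalerBr.
rewrite (_ : _ - _ = (E h x - x - h *: G x) - (E h y - y - h *: G y));
  last by rewrite [RHS]subrACA [X in _ = X - _]subrACA.
rewrite (le_trans (ler_normB _ _))// (le_trans (lerD (H1 h _) (H2 h _))) ?h0//.
by rewrite -mulrDl -splitr.
Qed.

(** [E h] commutes with [E t], so the difference quotient of [E t x] is the image of that of [x]
    under a bounded operator. *)
Lemma generator_orbit t x : 0 <= t -> D x ->
  D (E t x) /\ G (E t x) = E t (G x).
Proof.
move=> t0 Dx; apply: generatorP => e e0.
have lt := semigroup_linear t0; have [blE _ EM _] := sgE.
have [M M0 HM] := bounded_linear_pos (blE t t0).
have [d d0 Hd] := generator_quotient Dx (divr_gt0 e0 M0).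
exists d => // h /[dup] /andP[h0 _] /Hd H.
have -> : E h (E t x) = E t (E h x) by rewrite -!EM ?(ltW h0)// addrC.
rewrite -(linear_fZ lt) -!(linear_fB lt) (le_trans (HM _))//.
by rewrite mulrC -ler_pdivlMr// mulrAC.
Qed.

(** [G x] need not lie in [D], but it is the limit of [h^-1 *: (E h x - x)], which does; this
    carries a bound known only on [D] over to [G x]. *)
Lemma generator_norm_le t M x : 0 <= t -> 0 <= M -> D x ->
  (forall g, D g -> `|E t g| <= M * `|g|) -> `|E t (G x)| <= M * `|G x|.
Proof.
move=> t0 M0 Dx HM; apply/ler_addgt0Pr => e e0.
have lt := semigroup_linear t0; have [blE _ _ _] := sgE.
have [K K0 HK] := bounded_linear_pos (blE t t0).
have KM : 0 < M + K by lra.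
(* The remainder is counted [M] times inside the increment and [K] times on its own. *)
have [d d0 Hd] := generator_quotient Dx (divr_gt0 e0 KM).
have h0 : 0 < d / 2 by lra.
set h := d / 2 in h0.
have {Hd} H : `|E h x - x - h *: G x| <= e / (M + K) * h.
  by apply: Hd; rewrite h0 /= /h; lra.
have [Dh _] := generatorB (generator_orbit (ltW h0) Dx).1 Dx.
rewrite -(ler_pM2r h0).
have -> : `|E t (G x)| * h = `|E t (h *: G x)|.
  by rewrite (linear_fZ lt) normrZ (gtr0_norm h0) mulrC.
have -> : h *: G x = (E h x - x) - (E h x - x - h *: G x).
  by rewrite opprB addrC subrK.
rewrite (linear_fB lt) (le_trans (ler_normB _ _))//.
have H1 : `|E h x - x| <= h * `|G x| + e / (M + K) * h.
  rewrite -[E h x - x](subrK (h *: G x)) (le_trans (ler_normD _ _))//.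
  by rewrite normrZ (gtr0_norm h0) addrC lerD2l.
apply: (le_trans (lerD (HM _ Dh) (HK _))).
apply: (le_trans (y := M * (h * `|G x| + e / (M + K) * h)
                       + K * (e / (M + K) * h))).
  by rewrite lerD// ler_wpM2l// ltW.
rewrite le_eqVlt; apply/orP; left; apply/eqP.
by field; rewrite gt_eqF.
Qed.

(** In place of an integral of [E s (G x)], the displacement telescopes over a fine mesh; each
    increment is some [E s] applied to [E h x - x], which is nearly [h *: G x]. *)
Lemma orbit_displacement t M x : 0 < t -> 0 <= M -> D x ->
  (forall s g, 0 <= s <= t -> D g -> `|E s g| <= M * `|g|) ->
  `|E t x - x| <= M * t * `|G x|.
Proof.
move=> t0 M0 Dx HM; apply/ler_addgt0Pr => e e0.
(* The remainders add up to [e * (M * t / (M * t + 1))], at most [e]; the [1] covers [M = 0]. *)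
have Mt : 0 < M * t + 1 by rewrite ltr_wpDl// mulr_ge0// ltW.
have [d d0 Hd] := generator_quotient Dx (divr_gt0 e0 Mt).
have [N HN] : exists N : nat, t / d < N.+1%:R.
  by exists (Num.truncn (t / d)); exact: truncnS_gt.
have N0 : 0 < N.+1%:R :> R by [].
pose h := t / N.+1%:R.
have h0 : 0 < h by rewrite divr_gt0.
have hd : h < d by rewrite ltr_pdivrMr// mulrC -ltr_pdivrMr.
have tE : t = h * N.+1%:R by rewrite divfK// gt_eqF.
have {Hd} H : `|E h x - x - h *: G x| <= e / (M * t + 1) * h.
  by apply: Hd; rewrite h0.
have H1 : `|E h x - x| <= h * `|G x| + e / (M * t + 1) * h.
  rewrite -[E h x - x](subrK (h *: G x)) (le_trans (ler_normD _ _))//.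
  by rewrite normrZ (gtr0_norm h0) addrC lerD2l.
have [Dh _] := generatorB (generator_orbit (ltW h0) Dx).1 Dx.
have [_ E0 EM _] := sgE.
have step k : (k <= N.+1)%N ->
    `|E (h * k%:R) x - x| <= k%:R * (M * `|E h x - x|).
  elim: k => [|k IH] kN; first by rewrite mulr0 E0 subrr normr0 mul0r.
  have hk : 0 <= h * k%:R by rewrite mulr_ge0// ltW.
  have kt : h * k%:R <= t by rewrite tE ler_pM2l// ler_nat ltnW.
  rewrite -natr1 mulrDr mulr1 EM ?(ltW h0)//.
  have -> : E (h * k%:R) (E h x) - x
      = E (h * k%:R) (E h x - x) + (E (h * k%:R) x - x).
    by rewrite (linear_fB (semigroup_linear hk)) addrA subrK.
  rewrite (le_trans (ler_normD _ _))// mulrDl mul1r addrC lerD ?IH// 1?ltnW//.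
  by rewrite HM// hk.
have := step N.+1 (leqnn _); rewrite -tE => /le_trans; apply.
apply: (le_trans (y := N.+1%:R * (M * (h * `|G x| + e / (M * t + 1) * h)))).
  by rewrite ler_wpM2l// ler_wpM2l.
have -> : N.+1%:R * (M * (h * `|G x| + e / (M * t + 1) * h))
    = M * t * `|G x| + e * ((M * t) / (M * t + 1)).
  transitivity (M * (h * N.+1%:R) * `|G x|
      + e * (M * (h * N.+1%:R) / (M * t + 1))); last by rewrite -tE.
  by field; rewrite gt_eqF.
rewrite lerD2l ler_piMr ?(ltW e0)// ler_pdivrMr//; lra.
Qed.

End Generator.

(** * Contraction semigroups and the source integral *)

Section Contraction.
Context {R : realType} {V : normedModType R} {E : R -> V -> V}
  {D : set V} {A Ainv : V -> V}.
Hypothesis cE : C0_contraction_semigroup E.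
Hypothesis genE : is_generator E D (fun x => - A x).
Hypothesis invA : bounded_inverse D A Ainv.

Let sgE : C0_semigroup E := cE.1.

Lemma contraction_displacement t x : 0 < t -> D x ->
  `|E t x - x| <= t * `|A x|.
Proof.
move=> t0 Dx; have := orbit_displacement sgE genE t0 ler01 Dx.
rewrite mul1r normrN; apply=> s g /andP[s0 _] _.
by rewrite mul1r; exact: cE.2.
Qed.

(* Telescoping w - E(t) w over the mesh compares it with the Riemann sum of
   E(s) A w, which therefore converges without appeal to completeness. *)
Lemma sintE t v : 0 < t -> sint E t v = Ainv v - E t (Ainv v).
Proof.
move=> t0; set w := Ainv v.
have [DA AK _ _] := invA.
have Dw : D w by exact: DA.
have [_ E0 EM _] := sgE.
apply/cvg_lim => //; apply/cvgrPdist_le => e e0.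
have [d d0 Hd] := generator_quotient genE Dw (divr_gt0 e0 t0).
near=> N.
have N0 : 0 < N.+1%:R :> R by [].
pose h := t / N.+1%:R.
have h0 : 0 < h by rewrite divr_gt0.
have hd : h < d.
  rewrite ltr_pdivrMr// mulrC -ltr_pdivrMr//.
  apply: lt_trans (truncnS_gt _) _; rewrite ltr_nat ltnS.
  by near: N; exact: nbhs_infty_gt.
have tE : t = h * N.+1%:R by rewrite divfK// gt_eqF.
have Ek (k : nat) : t * k%:R / N.+1%:R = h * k%:R by rewrite mulrAC.
have hk0 (k : nat) : 0 <= h * k%:R by rewrite mulr_ge0// ltW.
have -> : w - E t w = \sum_(k < N.+1) (E (h * k%:R) (w - E h w)).
  rewrite -(big_mkord predT (fun k => E (h * k%:R) (w - E h w))).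
  rewrite (telescope_sumr_eq (fun k => - E (h * k%:R) w)).
    by rewrite mulr0 E0 opprK -tE addrC.
  by [].
  move=> k _; rewrite (linear_fB (semigroup_linear sgE (hk0 k))) opprK addrC.
  by rewrite -natr1 mulrDr mulr1 (EM _ h) ?(ltW h0)// addrC.
rewrite scaler_sumr -sumrB (le_trans (ler_norm_sum _ _ _))//.
(* The [N.+1] cells of length [h] fill [[0, t]], so each may contribute [e / t * h]. *)
have -> : e = \sum_(k < N.+1) (e / t * h).
  rewrite sumr_const card_ord -mulr_natr -mulrA -tE divfK// gt_eqF//.
apply: ler_sum => k _; rewrite Ek.
have lk := semigroup_linear sgE (hk0 k).
rewrite -(linear_fZ lk) -(linear_fB lk) (le_trans (cE.2 _ _ _))//.
have := Hd h; rewrite h0 => /(_ hd); rewrite AK scalerN opprK.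
by rewrite -normrN opprD opprB.
Unshelve. all: by end_near. Qed.

Lemma linear_sint t : 0 < t -> linear (sint E t).
Proof.
have [_ _ _ [lAinv _]] := invA.
move=> t0 a x y; rewrite !sintE// lAinv (semigroup_linear sgE (ltW t0)).
by rewrite opprD addrACA scalerBr.
Qed.

(** By the closed form this is the displacement of the orbit of [Ainv v], whose image under [A] is
    [v]. *)
Lemma sint_norm_le t v : 0 < t -> `|sint E t v| <= t * `|v|.
Proof.
have [DA AK _ _] := invA.
move=> t0; rewrite sintE// distrC (le_trans (contraction_displacement _ _))//.
by rewrite AK.
Qed.

End Contraction.

(** * Inhomogeneous equations driven by a contraction semigroup *)

Section Duhamel.
Context {R : realType} {V : normedModType R} {E : R -> V -> V}
  {D : set V} {A Ainv : V -> V}.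
Hypothesis cE : C0_contraction_semigroup E.
Hypothesis genE : is_generator E D (fun x => - A x).
Hypothesis invA : bounded_inverse D A Ainv.

Let sgE : C0_semigroup E := cE.1.

(** Factoring out [E s] gives left continuity of orbits from right continuity at time 0. *)
Lemma contraction_norm_sub t s x : 0 <= s <= t ->
  `|E t x - E s x| <= `|E (t - s) x - x|.
Proof.
move=> /andP[s0 st]; have ts : 0 <= t - s by rewrite subr_ge0.
have [_ _ EM _] := sgE.
rewrite (_ : E t x = E s (E (t - s) x)); last by rewrite -EM// addrC subrK.
by rewrite -(linear_fB (semigroup_linear sgE s0)) cE.2.
Qed.

(* A right-differential form of Duhamel's formula: no Banach-valued integral
   is needed, since w(s) = y(s) - E(s) y(0) satisfies
   |w(s+h)| <= |w(s)| + h |k(s)| + o(h). *)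
Lemma duhamel_le (y k : R -> V) T m : 0 <= T -> 0 <= m ->
  (forall s, 0 <= s <= T -> D (y s)) ->
  (forall t, 0 < t <= T -> forall e, 0 < e -> exists2 d, 0 < d &
     forall s, t - d < s < t -> 0 <= s -> `|y t - y s| <= e) ->
  (forall t, 0 <= t < T -> forall e, 0 < e -> exists2 d, 0 < d &
     forall h, 0 < h < d ->
     `|y (t + h) - y t - h *: (- A (y t) + k t)| <= e * h) ->
  (forall s, 0 <= s <= T -> `|k s| <= m) ->
  `|y T - E T (y 0)| <= m * T.
Proof.
move=> T0 m0 Dy yleft yright km; have [_ E0 EM Ecvg] := sgE.
have y0D : D (y 0) by apply: Dy; rewrite lexx.
(* The growth rate is 0 because [E] is a contraction: only the source makes the difference grow. *)
have := @dini_gronwall R (fun t => `|y t - E t (y 0)|) 0 m T T0 (lexx _) m0.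
rewrite E0 subrr normr0 mul0r expR0 mul1r add0r; apply=> //.
- move=> t tT e e0; have e2 : 0 < e / 2 by rewrite divr_gt0.
  have [d1 d10 H1] := yleft t tT _ e2.
  have [d2 d20 H2] := (cvg_at_right0P _ _).1 (Ecvg (y 0)) _ e2.
  exists (Num.min d1 d2) => [|s]; first by rewrite lt_min d10.
  move=> /andP[ds st] s0.
  have ds1 : t - d1 < s.
    by apply: le_lt_trans ds; rewrite lerB// ge_min lexx.
  have ds2 : t - d2 < s.
    by apply: le_lt_trans ds; rewrite lerB// ge_min lexx orbT.
  rewrite -[y t - _](subrK (y s - E s (y 0))) addrC.
  rewrite (le_trans (ler_normD _ _))// lerD2l subrACA.
  rewrite (le_trans (ler_normB _ _))// [e]splitr lerD ?H1 ?ds1//.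
  apply: (le_trans (contraction_norm_sub _ _)); first by rewrite s0 ltW.
  by apply: H2; apply/andP; split; lra.
- move=> t tT e e0; have e2 : 0 < e / 2 by rewrite divr_gt0.
  have t0T : 0 <= t <= T by move/andP: tT => [-> /ltW].
  have t0 : 0 <= t by move/andP: tT => [].
  have [d1 d10 H1] := yright t tT _ e2.
  have [d2 d20 H2] := generator_quotient genE (Dy t t0T) e2.
  exists (Num.min d1 d2) => [|h]; first by rewrite lt_min d10.
  rewrite lt_min => /and3P[h0 h1 h2]; rewrite mul0r addr0 mul1r.
  have I1 := H1 h ltac:(by rewrite h0); have I2 := H2 h ltac:(by rewrite h0).
  rewrite scalerDr in I1.
  apply: (le_trans (increment_norm_le (E (t + h) (y 0)) I1 I2)).
  have -> : E (t + h) (y 0) = E h (E t (y 0)).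
    by rewrite -EM ?(ltW h0)// [h + t]addrC.
  rewrite -mulrDl -splitr.
  rewrite -(linear_fB (semigroup_linear sgE (ltW h0))) mulrDl addrA.
  rewrite lerD2r lerD ?(cE.2 _ _ (ltW h0))//.
  by rewrite normrZ (gtr0_norm h0) mulrC ler_pM2r// km.
Qed.

(** Shift by [v = Ainv z], the stationary point for the constant source [z]. Since
    [sint E T z = v - E T v], the error is, up to sign, the Duhamel defect of [u - v], whose source
    is [g - z]. *)
Lemma duhamel_const_error (u g : R -> V) z T m : 0 < T -> 0 <= m ->
  (forall s, 0 <= s <= T -> D (u s)) ->
  (forall t, 0 < t <= T -> forall e, 0 < e -> exists2 d, 0 < d &
     forall s, t - d < s < t -> 0 <= s -> `|u t - u s| <= e) ->
  (forall t, 0 <= t < T -> forall e, 0 < e -> exists2 d, 0 < d &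
     forall h, 0 < h < d ->
     `|u (t + h) - u t - h *: (- A (u t) + g t)| <= e * h) ->
  (forall s, 0 <= s <= T -> `|g s - z| <= m) ->
  `|E T (u 0) + sint E T z - u T| <= m * T.
Proof.
move=> T0 m0 Du uleft uright gm; have [DA AK _ _] := invA.
set v := Ainv z.
have sub_v s : 0 <= s <= T -> D (u s - v) /\ - A (u s - v) = - A (u s) + z.
  move=> /Du Dus; have [? ->] := generatorB sgE genE Dus (DA z).
  by rewrite opprK AK.
have := @duhamel_le (fun s => u s - v) (fun s => g s - z) T m (ltW T0) m0.
have -> : u T - v - E T (u 0 - v) = - (E T (u 0) + sint E T z - u T).
  rewrite (sintE cE genE invA)// (linear_fB (semigroup_linear sgE (ltW T0))).
  by rewrite -/v subrACA [RHS]opprB [in RHS]opprD addrA.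
rewrite normrN; apply=> //.
- by move=> s /sub_v [].
- move=> t tT e e0; have [d d0 Hd] := uleft t tT e e0.
  by exists d => // s sd s0; rewrite subrACA subrr subr0 Hd.
- move=> t tT e e0; have [d d0 Hd] := uright t tT e e0.
  exists d => // h hd; rewrite subrACA subrr subr0.
  have [_ ->] := sub_v t ltac:(by case/andP: tT => -> /ltW ->).
  by rewrite addrACA subrr addr0 Hd.
Qed.

End Duhamel.

(** * Uniform boundedness near time 0 *)

(** Otherwise there are [t_n -> 0] and [x_n] with [|F t_n x_n| > n |x_n|]. For each fixed [x] the
    sequence [F t_n x] converges, hence is bounded, and Banach-Steinhaus on [V] bounds all [F t_n]
    at once. *)
Lemma strong_bounded_at_right0 {R : realType} {V : completeNormedModType R}
    {W : normedModType R} (F : R -> V -> W) :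
  (forall t, 0 < t -> bounded_linear (F t)) ->
  (forall x, cvg (F t x @[t --> 0^'+])) ->
  exists2 d, 0 < d & exists M, forall t x, 0 < t < d -> `|F t x| <= M * `|x|.
Proof.
move=> bF cF; apply: contrapT => nF.
have bad n : exists tx : R * V,
    0 < tx.1 < n.+1%:R^-1 /\ n%:R * `|tx.2| < `|F tx.1 tx.2|.
  apply: contrapT => nex; apply: nF; exists n.+1%:R^-1; first by rewrite invr_gt0.
  exists n%:R => t x tn; rewrite leNgt; apply/negP => H.
  by apply: nex; exists (t, x).
have [tx Htx] := choice bad.
pose T := range (fun n => F (tx n).1).
have t0 n : 0 < (tx n).1 by have [/andP[]] := Htx n.
have [M HM] : exists M, forall f, T f -> forall x, `|x| <= 1 -> `|f x| <= M.
  apply: (Banach_Steinhauss (F := T)) => [_ [n _ <-]|x].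
    have bFn := bF _ (t0 n); split; last exact: bFn.1.
    move=> r; have [K K0 HK] := bounded_linear_pos bFn.
    by exists (K * r) => x xr; rewrite (le_trans (HK x))// ler_wpM2l// ltW.
  have Fx : cvgn (fun n => F (tx n).1 x).
    have /cvg_ex[l Hl] := cF x; apply/cvg_ex; exists l.
    apply/cvgrPdist_le => e e0; have [d d0 Hd] := (cvg_at_right0P _ _).1 Hl e e0.
    near=> n; rewrite distrC Hd// t0 /=.
    have [/andP[_ tn] _] := Htx n; apply: (lt_trans tn).
    by near: n; exact: (near_infty_natSinv_lt (PosNum d0)).
  have [K [_ HK]] := cvg_seq_bounded Fx.
  exists (K + 1) => _ [n _ <-]; apply: (HK (K + 1)); last by [].
  by rewrite ltrDl.
(* At an index beyond the uniform bound [M], the normalised [x_n] contradicts that bound. *)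
pose n := (Num.truncn M).+1.
have Mn : M < n%:R by exact: truncnS_gt.
have [_] := Htx n; set t := (tx n).1; set x := (tx n).2 => Hx.
have [x0|x0] := eqVneq x 0.
  by move: Hx; rewrite x0 (linear_f0 (bF _ (t0 n)).1) !normr0 mulr0 ltxx.
have nx : 0 < `|x| by rewrite normr_gt0.
have := HM (F t) (ex_intro2 _ _ n I erefl) (`|x|^-1 *: x).
rewrite (linear_fZ (bF _ (t0 n)).1) !normrZ normfV normr_id mulVf ?gt_eqF//.
move=> /(_ (lexx _)); rewrite mulrC ler_pdivrMr// => H.
have := lt_le_trans Hx H; rewrite ltr_pM2r// => /(lt_trans Mn).
by rewrite ltxx.
Unshelve. all: by end_near. Qed.

(** * The max norm of the product against the Hilbert-sum norm *)

Section ProductNorm.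
Context {R : realType} {X1 X2 : normedModType R}.
Implicit Type f : X1 * X2.

Lemma norm_fst_le f : `|f.1| <= `|f|.
Proof. by rewrite prod_normE le_max lexx. Qed.

Lemma norm_snd_le f : `|f.2| <= `|f|.
Proof. by rewrite prod_normE le_max lexx orbT. Qed.

Lemma prod_norm_le f M : `|f.1| <= M -> `|f.2| <= M -> `|f| <= M.
Proof. by rewrite prod_normE ge_max => -> ->. Qed.

Lemma prod_norm_le_pnorm f : `|f| <= pnorm f.
Proof.
have sq0 (x y : R) : 0 <= x -> 0 <= y -> x <= Num.sqrt (x ^+ 2 + y ^+ 2).
  by move=> x0 y0; rewrite -{1}[x]ger0_norm// -sqrtr_sqr ler_wsqrtr// lerDl exprn_ge0.
by apply: prod_norm_le; rewrite /pnorm ?sq0//; rewrite addrC sq0.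
Qed.

Lemma pnorm_le_prod_norm f : pnorm f <= 2 * `|f|.
Proof.
have f0 : 0 <= 2 * `|f| by rewrite mulr_ge0.
rewrite -[leRHS]ger0_norm// -sqrtr_sqr ler_wsqrtr//.
have h1 : `|f.1| ^+ 2 <= `|f| ^+ 2 by rewrite ler_sqr ?nnegrE// norm_fst_le.
have h2 : `|f.2| ^+ 2 <= `|f| ^+ 2 by rewrite ler_sqr ?nnegrE// norm_snd_le.
by rewrite exprMn; have := sqr_ge0 `|f|; lra.
Qed.

End ProductNorm.

(** * Local boundedness and left continuity on the product space *)

Section ProductSemigroup.
Context {R : realType} {X1 X2 : completeNormedModType R}
  {S : R -> X1 * X2 -> X1 * X2}.
Hypothesis sgS : C0_semigroup S.

(* The uniform boundedness principle is applied on each factor, which avoids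
   the completeness of the product. *)
Lemma prod_semigroup_locally_bounded :
  exists2 d, 0 < d &
    exists2 M, 0 <= M & forall t f, 0 < t < d -> `|S t f| <= M * `|f|.
Proof.
have [bS _ _ cS] := sgS.
have lS := semigroup_linear sgS.
have [|x|d1 d10 [M1 H1]] :=
    @strong_bounded_at_right0 R X1 _ (fun t x => S t (x, 0)).
- move=> t t0; split=> [a x y|].
    rewrite -(lS t (ltW t0)) -[RHS]/(S t (_, _)).
    by rewrite /= scaler0 addr0.
  have [M M0 HM] := bounded_linear_pos (bS t (ltW t0)).
  exists M => x; rewrite (le_trans (HM _))// (ler_wpM2l (ltW M0))//.
  by apply: prod_norm_le; rewrite ?normr0.
- by apply/cvg_ex; exists (x, 0).
have [|x|d2 d20 [M2 H2]] :=
    @strong_bounded_at_right0 R X2 _ (fun t x => S t (0, x)).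
- move=> t t0; split=> [a x y|].
    rewrite -(lS t (ltW t0)) -[RHS]/(S t (_, _)).
    by rewrite /= scaler0 addr0.
  have [M M0 HM] := bounded_linear_pos (bS t (ltW t0)).
  exists M => x; rewrite (le_trans (HM _))// (ler_wpM2l (ltW M0))//.
  by apply: prod_norm_le; rewrite ?normr0.
- by apply/cvg_ex; exists (0, x).
exists (Num.min d1 d2); first by rewrite lt_min d10.
exists (`|M1| + `|M2|); first by rewrite addr_ge0.
move=> t f; rewrite lt_min => /and3P[t0 t1 t2].
have fE : f = (f.1, 0) + (0, f.2).
  by case: f => x y; rewrite /= -[RHS]/(_, _) /= addr0 add0r.
rewrite [in S t f]fE (linear_fD (lS t (ltW t0))) (le_trans (ler_normD _ _))//.
rewrite mulrDl lerD//.
  rewrite (le_trans (H1 t f.1 _)) ?t0// (le_trans (ler_wpM2r _ (ler_norm M1)))//.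
  by rewrite ler_wpM2l// norm_fst_le.
rewrite (le_trans (H2 t f.2 _)) ?t0// (le_trans (ler_wpM2r _ (ler_norm M2)))//.
by rewrite ler_wpM2l// norm_snd_le.
Qed.

(** For [t - r < s < t], [S s] is a short step after the fixed bounded operator [S (t - r)], hence
    bounded uniformly in [s]; so [S t f - S s f = S s (S (t - s) f - f)] is small. *)
Lemma prod_semigroup_left_continuous t f : 0 < t ->
  forall e, 0 < e -> exists2 d, 0 < d &
    forall s, t - d < s < t -> 0 <= s -> `|S t f - S s f| <= e.
Proof.
move=> t0 e e0; have [bS S0 SM cS] := sgS.
have [d0 d00 [M M0 HM]] := prod_semigroup_locally_bounded.
pose r := Num.min d0 t / 2.
have m0 : 0 < Num.min d0 t by rewrite lt_min d00.
have r0 : 0 < r by rewrite divr_gt0.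
have rd : r < d0.
  by rewrite (lt_le_trans (y := Num.min d0 t)) ?ge_min ?lexx// /r; lra.
have rt : r < t.
  by rewrite (lt_le_trans (y := Num.min d0 t)) ?ge_min ?lexx ?orbT// /r; lra.
have tr : 0 <= t - r by rewrite subr_ge0 ltW.
have [K K0 HK] := bounded_linear_pos (bS _ tr).
have MK : 0 < M * K + 1 by rewrite ltr_wpDl// mulr_ge0// ltW.
have [d d1 Hd] := (cvg_at_right0P _ _).1 (cS f) _ (divr_gt0 e0 MK).
exists (Num.min d r) => [|s]; first by rewrite lt_min d1.
move=> /andP[ds st] s0.
have ds1 : t - d < s by apply: le_lt_trans ds; rewrite lerB// ge_min lexx.
have ds2 : t - r < s by apply: le_lt_trans ds; rewrite lerB// ge_min lexx orbT.
have -> : S t f = S s (S (t - s) f).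
  by rewrite -SM ?subr_ge0 ?(ltW st)// [s + _]addrC subrK.
have lS := semigroup_linear sgS.
rewrite -(linear_fB (lS s s0)).
have -> g : S s g = S (s - (t - r)) (S (t - r) g).
  by rewrite -SM ?subrK// subr_ge0 ltW.
rewrite (le_trans (HM _ _ _))//; first by apply/andP; split; lra.
apply: (le_trans (ler_wpM2l M0 (HK _))).
apply: (le_trans (ler_wpM2l M0 (ler_wpM2l (ltW K0) (Hd (t - s) _)))).
  by apply/andP; split; lra.
rewrite mulrA mulrA ler_pdivrMr// [leLHS]mulrC ler_wpM2l ?(ltW e0)//; lra.
Qed.

End ProductSemigroup.

(** * Stability, local error and iteration of the split step *)

Section SplitStep.
Context {R : realType} {X1 X2 : completeNormedModType R}
  {E1 : R -> X1 -> X1} {E2 : R -> X2 -> X2}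
  {D1 : set X1} {A1 : X1 -> X1} {D2 : set X2} {A2 : X2 -> X2}
  {B1 : X2 -> X1} {B2 : X1 -> X2}
  {A1inv : X1 -> X1} {A2inv : X2 -> X2}
  {S : R -> X1 * X2 -> X1 * X2}.
Hypothesis cE1 : C0_contraction_semigroup E1.
Hypothesis genE1 : is_generator E1 D1 (fun x => - A1 x).
Hypothesis cE2 : C0_contraction_semigroup E2.
Hypothesis genE2 : is_generator E2 D2 (fun x => - A2 x).
Hypothesis bB1 : bounded_linear B1.
Hypothesis bB2 : bounded_linear B2.
Hypothesis invA1 : bounded_inverse D1 A1 A1inv.
Hypothesis invA2 : bounded_inverse D2 A2 A2inv.

Let C (f : X1 * X2) : X1 * X2 := (A1 f.1 - B1 f.2, A2 f.2 - B2 f.1).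

Hypothesis sgS : C0_semigroup S.
Hypothesis genS : is_generator S (D1 `*` D2) (fun f => - C f).

Let b := opnorm B1 + opnorm B2.
Let T := split_step E1 E2 B1 B2.

Let b1_ge0 : 0 <= opnorm B1 := opnorm_ge0 bB1.
Let b2_ge0 : 0 <= opnorm B2 := opnorm_ge0 bB2.
Let b_ge0 : 0 <= b := addr_ge0 b1_ge0 b2_ge0.

Let B1_le x (M : R) : `|x| <= M -> `|B1 x| <= opnorm B1 * M.
Proof. by move=> xM; rewrite (le_trans (le_opnorm bB1 x))// ler_wpM2l. Qed.

Let B2_le x (M : R) : `|x| <= M -> `|B2 x| <= opnorm B2 * M.
Proof. by move=> xM; rewrite (le_trans (le_opnorm bB2 x))// ler_wpM2l. Qed.

Let oppC f : - C f = (- A1 f.1 + B1 f.2, - A2 f.2 + B2 f.1).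
Proof. by rewrite /C -[LHS]/(_, _) /= !opprD !opprK. Qed.

(** Componentwise, the orbit solves two equations, each driven by its own [A_j] with the other
    component as source: the form that [duhamel_const_error] takes. *)
Lemma orbit_quotient t f : 0 <= t -> (D1 `*` D2) f ->
  forall e, 0 < e -> exists2 d, 0 < d & forall h, 0 < h < d ->
    `|(S (t + h) f).1 - (S t f).1
      - h *: (- A1 (S t f).1 + B1 (S t f).2)| <= e * h /\
    `|(S (t + h) f).2 - (S t f).2
      - h *: (- A2 (S t f).2 + B2 (S t f).1)| <= e * h.
Proof.
move=> t0 Df e e0; have [_ _ SM _] := sgS.
have [Dt _] := generator_orbit sgS genS t0 Df.
have [d d0 Hd] := generator_quotient genS Dt e0.
exists d => // h /[dup] /andP[h0 _] /Hd.
rewrite -SM ?(ltW h0)// [h + t]addrC oppC; set r := (X in `|X| <= _) => H.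
by split; [exact: le_trans (norm_fst_le r) H|exact: le_trans (norm_snd_le r) H].
Qed.

(** To first order a time step is a contraction in each component plus a source of norm at most
    [h * b * |S s f|]; in the max norm both components fit under the factor [1 + b * h]. *)
Lemma perturbed_semigroup_norm_le t f : 0 <= t -> (D1 `*` D2) f ->
  `|S t f| <= expR (b * t) * `|f|.
Proof.
move=> t0 Df; have [_ S0 _ _] := sgS.
have := @dini_gronwall R (fun s => `|S s f|) b 0 t t0 b_ge0 (lexx _).
rewrite S0 mul0r addr0; apply=> //.
  move=> s /andP[s0 _] e e0.
  have [d d0 Hd] := prod_semigroup_left_continuous sgS f s0 e0.
  exists d => // r rd r0; rewrite -lerBlDl (le_trans (lerB_dist _ _))//.
  exact: Hd.
move=> s /andP[s0 _] e e0; have e2 : 0 < e / 2 by rewrite divr_gt0.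
have [[/= DS1 DS2] _] := generator_orbit sgS genS s0 Df.
have [d d0 Hd] := orbit_quotient s0 Df e2.
have [d1 d10 H1] := generator_quotient genE1 DS1 e2.
have [d2 d20 H2] := generator_quotient genE2 DS2 e2.
exists (Num.min d (Num.min d1 d2)) => [|h]; first by rewrite !lt_min d0 d10.
rewrite !lt_min => /and4P[h0 hd hd1 hd2].
have [I1 I2] := Hd h ltac:(by rewrite h0).
have J1 := H1 h ltac:(by rewrite h0); have J2 := H2 h ltac:(by rewrite h0).
rewrite scalerDr in I1; rewrite scalerDr in I2.
have K1 := increment_norm_le 0 I1 J1; have K2 := increment_norm_le 0 I2 J2.
rewrite !subr0 -mulrDl -splitr normrZ (gtr0_norm h0) in K1.
rewrite !subr0 -mulrDl -splitr normrZ (gtr0_norm h0) in K2.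
rewrite add0r; apply: prod_norm_le.
  apply: (le_trans K1); rewrite lerD2r mulrDl mul1r lerD//.
    by rewrite (le_trans (cE1.2 _ _ (ltW h0)))// norm_fst_le.
  rewrite mulrAC mulrC ler_wpM2r ?(ltW h0)// (le_trans (B1_le (norm_snd_le _)))//.
  by rewrite ler_wpM2r// lerDl.
apply: (le_trans K2); rewrite lerD2r mulrDl mul1r lerD//.
  by rewrite (le_trans (cE2.2 _ _ (ltW h0)))// norm_snd_le.
rewrite mulrAC mulrC ler_wpM2r ?(ltW h0)// (le_trans (B2_le (norm_fst_le _)))//.
by rewrite ler_wpM2r// lerDr.
Qed.

(** [C] commutes with [S t] on the domain, and the growth bound there extends to [C f] by
    [generator_norm_le]. *)
Lemma perturbed_generator_norm_le t f : 0 <= t -> (D1 `*` D2) f ->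
  `|C (S t f)| <= expR (b * t) * `|C f|.
Proof.
move=> t0 Df; have [_ Ct] := generator_orbit sgS genS t0 Df.
rewrite -normrN Ct -(normrN (C f)).
apply: (generator_norm_le sgS genS t0 (expR_ge0 _) Df) => g.
exact: perturbed_semigroup_norm_le.
Qed.

Lemma perturbed_displacement s t f : 0 <= s <= t -> (D1 `*` D2) f ->
  `|S s f - f| <= t * expR (b * t) * `|C f|.
Proof.
move=> /andP[s0 st] Df; have [_ S0 _ _] := sgS.
have et : 0 <= expR (b * t) by exact: expR_ge0.
have [->|sn0] := eqVneq s 0.
  by rewrite S0 subrr normr0 !mulr_ge0// (le_trans s0).
have {sn0} sp : 0 < s by rewrite lt_neqAle eq_sym sn0.
rewrite -(normrN (C f)).
apply: (le_trans (orbit_displacement sgS genS sp (expR_ge0 (b * t)) Df _)).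
  move=> r g /andP[r0 rs] Dg.
  rewrite (le_trans (perturbed_semigroup_norm_le r0 Dg))// ler_wpM2r//.
  by rewrite ler_expR ler_wpM2l// (le_trans rs).
by rewrite ler_wpM2r// mulrC ler_wpM2r.
Qed.

(** Linearity merges the two source terms of the second component: the step advances the first
    component with [f.2] frozen, then the second with the updated first component frozen. *)
Lemma split_stepE tau f : 0 < tau ->
  T tau f = (E1 tau f.1 + sint E1 tau (B1 f.2),
             E2 tau f.2 + sint E2 tau (B2 (E1 tau f.1 + sint E1 tau (B1 f.2)))).
Proof.
move=> tau0; rewrite /T /split_step; congr (_, _).
rewrite -(linear_fD (linear_sint cE2 genE2 invA2 tau0)) -(linear_fD bB2.1).
by rewrite addrC.
Qed.

Lemma split_stepB tau f g : 0 < tau -> T tau f - T tau g = T tau (f - g).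
Proof.
move=> tau0; rewrite !split_stepE//.
have l1 := linear_sint cE1 genE1 invA1 tau0.
have l2 := linear_sint cE2 genE2 invA2 tau0.
have e1 := semigroup_linear cE1.1 (ltW tau0).
have e2 := semigroup_linear cE2.1 (ltW tau0).
have fst_B : E1 tau (f - g).1 + sint E1 tau (B1 (f - g).2) =
    E1 tau f.1 + sint E1 tau (B1 f.2) - (E1 tau g.1 + sint E1 tau (B1 g.2)).
  rewrite /= (linear_fB e1) (linear_fB bB1.1) (linear_fB l1).
  by rewrite opprD addrACA.
rewrite fst_B -[LHS]/(_, _); congr (_, _).
rewrite /= (linear_fB e2) (linear_fB bB2.1) (linear_fB l2).
by rewrite [RHS]addrACA -opprD.
Qed.

(** Each half step costs a factor [1 + |B_j| * tau <= expR (|B_j| * tau)]. The product has no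
    constant in front, so powers of the step stay controlled. *)
Lemma split_step_norm_le tau f : 0 < tau ->
  `|T tau f| <= expR (b * tau) * `|f|.
Proof.
move=> tau0; rewrite split_stepE//; set g1 := _ + sint E1 _ _.
have hb1 : 1 + opnorm B1 * tau <= expR (opnorm B1 * tau) by exact: expR_ge1Dx.
have hb2 : 1 + opnorm B2 * tau <= expR (opnorm B2 * tau) by exact: expR_ge1Dx.
have t1 : 0 <= opnorm B1 * tau by rewrite mulr_ge0// ltW.
have t2 : 0 <= opnorm B2 * tau by rewrite mulr_ge0// ltW.
have g1_le : `|g1| <= expR (opnorm B1 * tau) * `|f|.
  apply: (le_trans _ (ler_wpM2r (normr_ge0 f) hb1)).
  rewrite mulrDl mul1r (le_trans (ler_normD _ _))// lerD//.
    by rewrite (le_trans (cE1.2 _ _ (ltW tau0)))// norm_fst_le.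
  rewrite (le_trans (sint_norm_le cE1 genE1 invA1 _ tau0))//.
  by rewrite mulrAC mulrC ler_wpM2r ?(ltW tau0)// B1_le// norm_snd_le.
have f_le : `|f| <= expR (opnorm B1 * tau) * `|f|.
  by rewrite ler_peMl//; lra.
have -> : expR (b * tau) = expR (opnorm B2 * tau) * expR (opnorm B1 * tau).
  by rewrite -expRD /b mulrDl addrC.
rewrite -mulrA; apply: prod_norm_le => /=.
  by rewrite (le_trans g1_le)// ler_peMl ?mulr_ge0 ?expR_ge0//; lra.
apply: (le_trans _ (ler_wpM2r _ hb2)); last by rewrite mulr_ge0 ?expR_ge0.
rewrite mulrDl mul1r (le_trans (ler_normD _ _))// lerD//.
  rewrite (le_trans (cE2.2 _ _ (ltW tau0)))//.
  exact: le_trans (norm_snd_le _) f_le.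
rewrite (le_trans (sint_norm_le cE2 genE2 invA2 _ tau0))//.
by rewrite mulrAC mulrC ler_wpM2r ?(ltW tau0)// B2_le.
Qed.

(* A Lyapunov-type substitute for the graph norm |A f|: unlike |A f|, it grows
   along S by at most the factor e^{bt}, with no extra constant, so it iterates. *)
Let N f := `|C f| + b * `|f|.

Let N_ge0 f : 0 <= N f.
Proof. by rewrite addr_ge0// mulr_ge0. Qed.

(** Each half step solves its equation with a frozen source, from which the exact source differs by
    [O(tau)] during the step; [duhamel_const_error] multiplies this discrepancy by [tau]. *)
Lemma split_step_local_error tau f : 0 < tau -> (D1 `*` D2) f ->
  `|T tau f - S tau f| <= 3 * b * tau ^+ 2 * expR (b * tau) * N f.
Proof.
move=> tau0 Df; have [_ S0 _ _] := sgS.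
set X := expR (b * tau).
have X1' : 1 <= X by rewrite -expR0 ler_expR mulr_ge0// ltW.
have XN : 0 <= tau * X * N f by rewrite !mulr_ge0 ?expR_ge0// ltW.
have C_le : `|C f| <= N f by rewrite lerDl mulr_ge0.
have bf_le : b * `|f| <= N f by rewrite lerDr.
have disp s : 0 <= s <= tau -> `|S s f - f| <= tau * X * N f.
  move=> st; rewrite (le_trans (perturbed_displacement st Df))//.
  by rewrite ler_wpM2l// mulr_ge0 ?expR_ge0// ltW.
have tauN : tau * N f <= tau * X * N f.
  by rewrite ler_wpM2r// ler_peMr// ltW.
have DS s : 0 <= s <= tau -> (D1 `*` D2) (S s f).
  by move=> /andP[s0 _]; have [] := generator_orbit sgS genS s0 Df.
have left_cont t : 0 < t <= tau -> forall e, 0 < e -> exists2 d, 0 < d &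
    forall s, t - d < s < t -> 0 <= s ->
    `|(S t f).1 - (S s f).1| <= e /\ `|(S t f).2 - (S s f).2| <= e.
  move=> /andP[t0 _] e e0.
  have [d d0 Hd] := prod_semigroup_left_continuous sgS f t0 e0.
  exists d => // s sd s0; have H := Hd s sd s0.
  by split; [exact: le_trans (norm_fst_le _) H|exact: le_trans (norm_snd_le _) H].
rewrite split_stepE//; set g1 := _ + sint E1 _ _.
have err1 : `|g1 - (S tau f).1| <= opnorm B1 * (tau * X * N f) * tau.
  have := @duhamel_const_error R X1 E1 D1 A1 A1inv cE1 genE1 invA1
    (fun s => (S s f).1) (fun s => B1 (S s f).2) (B1 f.2) tau
    (opnorm B1 * (tau * X * N f)) tau0 (mulr_ge0 b1_ge0 XN).
  rewrite S0; apply=> //.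
  - by move=> s /DS [].
  - move=> t tt e e0; have [d d0 Hd] := left_cont t tt e e0.
    by exists d => // s sd s0; have [] := Hd s sd s0.
  - move=> t /andP[t0 _] e e0; have [d d0 Hd] := orbit_quotient t0 Df e0.
    by exists d => // h /Hd [].
  - move=> s /disp H; rewrite -(linear_fB bB1.1) B1_le//.
    exact: le_trans (norm_snd_le (S s f - f)) H.
have A1_le : `|A1 f.1| <= N f.
  have -> : A1 f.1 = (C f).1 + B1 f.2 by rewrite /= subrK.
  rewrite (le_trans (ler_normD _ _))// lerD ?norm_fst_le//.
  by rewrite (le_trans (B1_le (norm_snd_le _)))// ler_wpM2r// lerDl.
have E1_le : `|E1 tau f.1 - f.1| <= tau * X * N f.
  apply: le_trans tauN.
  rewrite (le_trans (contraction_displacement cE1 genE1 tau0 Df.1))//.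
  by rewrite ler_wpM2l// ltW.
have sint1_le : `|sint E1 tau (B1 f.2)| <= tau * X * N f.
  apply: le_trans tauN.
  rewrite (le_trans (sint_norm_le cE1 genE1 invA1 _ tau0))// ler_wpM2l ?(ltW tau0)//.
  rewrite (le_trans (B1_le (norm_snd_le _)))// (le_trans _ bf_le)//.
  by rewrite ler_wpM2r// lerDl.
have err2 : `|E2 tau f.2 + sint E2 tau (B2 g1) - (S tau f).2|
    <= opnorm B2 * (3 * (tau * X * N f)) * tau.
  have := @duhamel_const_error R X2 E2 D2 A2 A2inv cE2 genE2 invA2
    (fun s => (S s f).2) (fun s => B2 (S s f).1) (B2 g1) tau
    (opnorm B2 * (3 * (tau * X * N f))) tau0
    (mulr_ge0 b2_ge0 (mulr_ge0 (ler0n _ 3) XN)).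
  rewrite S0; apply=> //.
  - by move=> s /DS [].
  - move=> t tt e e0; have [d d0 Hd] := left_cont t tt e e0.
    by exists d => // s sd s0; have [] := Hd s sd s0.
  - move=> t /andP[t0 _] e e0; have [d d0 Hd] := orbit_quotient t0 Df e0.
    by exists d => // h /Hd [].
  - move=> s /disp H; rewrite -(linear_fB bB2.1) B2_le//.
    (* The displacement of the exact orbit, that of [E1] and the source integral are each at most
       [tau * X * N f], whence the factor 3. *)
    have -> : (S s f).1 - g1
        = (S s f - f).1 - (E1 tau f.1 - f.1) - sint E1 tau (B1 f.2).
      by rewrite /= /g1 opprB addrA subrK opprD addrA.
    rewrite (le_trans (ler_normB _ _))//.
    rewrite (le_trans (lerD (ler_normB _ _) (lexx _)))//.
    have := le_trans (norm_fst_le (S s f - f)) H; lra.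
have bX : opnorm B1 * (tau * X * N f) <= b * (tau * X * N f).
  by rewrite ler_wpM2r// lerDl.
have bX2 : opnorm B2 * (3 * (tau * X * N f)) <= 3 * b * (tau * X * N f).
  by rewrite mulrCA mulrA ler_wpM2r// ler_pM2l// lerDr.
have -> : 3 * b * tau ^+ 2 * X * N f = 3 * b * (tau * X * N f) * tau.
  by rewrite expr2; ring.
have bXN : 0 <= b * (tau * X * N f) by rewrite mulr_ge0.
apply: prod_norm_le => /=.
  by rewrite (le_trans err1)// ler_wpM2r ?(ltW tau0)//; lra.
by rewrite (le_trans err2)// ler_wpM2r ?(ltW tau0).
Qed.

(** Peel off the first step: stability carries the local error at [f] through [n] steps, and the
    induction hypothesis is applied at [S tau f], where [N] has grown by at most [expR (b * tau)].
    Both terms then share one exponential. *)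
Lemma split_step_iter_error tau n f : 0 < tau -> (D1 `*` D2) f ->
  `|iter n (T tau) f - S (n%:R * tau) f|
    <= n%:R * (3 * b * tau ^+ 2) * expR (b * (n%:R * tau)) * N f.
Proof.
move=> tau0; have [_ S0 SM _] := sgS; have tau_ge0 := ltW tau0.
have iterB m g h : `|iter m (T tau) g - iter m (T tau) h|
    <= expR (b * (m%:R * tau)) * `|g - h|.
  elim: m => [|m IH]; first by rewrite !mul0r mulr0 expR0 mul1r.
  rewrite !iterS split_stepB// (le_trans (split_step_norm_le _ tau0))//.
  have -> : b * (m.+1%:R * tau) = b * tau + b * (m%:R * tau).
    by rewrite -natr1; ring.
  rewrite expRD -mulrA.
  by rewrite ler_wpM2l ?expR_ge0.
elim: n f => [|n IH] f Df.
  by rewrite /= !mul0r S0 subrr normr0.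
have [DS _] := generator_orbit sgS genS tau_ge0 Df.
have N_S : N (S tau f) <= expR (b * tau) * N f.
  rewrite /N mulrDr lerD ?perturbed_generator_norm_le//.
  by rewrite mulrCA ler_wpM2l// perturbed_semigroup_norm_le.
have nt : 0 <= n%:R * tau by rewrite mulr_ge0.
rewrite -natr1 [(n%:R + 1) * tau]mulrDl mul1r SM// iterSr.
have -> : iter n (T tau) (T tau f) - S (n%:R * tau) (S tau f)
    = (iter n (T tau) (T tau f) - iter n (T tau) (S tau f))
      + (iter n (T tau) (S tau f) - S (n%:R * tau) (S tau f)).
  by rewrite addrA subrK.
rewrite (le_trans (ler_normD _ _))//.
apply: (le_trans (lerD (iterB _ _ _) (IH _ DS))).
set X := expR (b * (n%:R * tau)); set Y := expR (b * tau) in N_S *.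
have -> : expR (b * (n%:R * tau + tau)) = X * Y by rewrite mulrDr expRD.
apply: (le_trans (y := X * (3 * b * tau ^+ 2 * Y * N f)
    + n%:R * (3 * b * tau ^+ 2) * X * (Y * N f))).
  apply: lerD; rewrite ler_wpM2l ?expR_ge0//.
    exact: split_step_local_error.
  by rewrite !mulr_ge0 ?expR_ge0// exprn_ge0.
by rewrite le_eqVlt; apply/orP; left; apply/eqP; ring.
Qed.

(** Both [C = A - B] and the second summand of [N] contribute [b * |f|], whence the 2. *)
Lemma graph_quantity_le f (a : R) : `|(A1 f.1, A2 f.2)| <= 1 -> `|f| <= a ->
  N f <= 1 + 2 * b * a.
Proof.
move=> Af fa; rewrite /N.
have -> : C f = (A1 f.1, A2 f.2) - (B1 f.2, B2 f.1) by [].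
have Bf : `|(B1 f.2, B2 f.1)| <= b * `|f|.
  apply: prod_norm_le => /=.
    by rewrite (le_trans (B1_le (norm_snd_le f)))// ler_wpM2r// lerDl.
  by rewrite (le_trans (B2_le (norm_fst_le f)))// ler_wpM2r// lerDr.
have bfa : b * `|f| <= b * a by rewrite ler_wpM2l.
have := ler_normB (A1 f.1, A2 f.2) (B1 f.2, B2 f.1); lra.
Qed.

End SplitStep.

(** * The global estimate in the Hilbert-sum norm *)

Theorem theorem4p5 (R : realType) :
  exists Cst : R -> R -> R -> R -> R,
    (forall b2 b1 a1 a2, 0 < Cst b2 b1 a1 a2) /\
    forall (X1 X2 : completeNormedModType R)
      (E1 : R -> X1 -> X1) (E2 : R -> X2 -> X2)
      (D1 : set X1) (A1 : X1 -> X1) (D2 : set X2) (A2 : X2 -> X2)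
      (B1 : X2 -> X1) (B2 : X1 -> X2)
      (A1inv : X1 -> X1) (A2inv : X2 -> X2)
      (S : R -> X1 * X2 -> X1 * X2),
    C0_contraction_semigroup E1 -> is_generator E1 D1 (fun x => - A1 x) ->
    C0_contraction_semigroup E2 -> is_generator E2 D2 (fun x => - A2 x) ->
    bounded_linear B1 -> bounded_linear B2 ->
    (* A = diag(A1, A2) boundedly invertible *)
    bounded_inverse D1 A1 A1inv -> bounded_inverse D2 A2 A2inv ->
    (* C = A - B on dom(A) = D1 x D2, boundedly invertible *)
    let Aop := fun f : X1 * X2 => (A1 f.1, A2 f.2) in
    let Cop := fun f : X1 * X2 => (A1 f.1 - B1 f.2, A2 f.2 - B2 f.1) in
    (exists Cinv, bounded_inverse (D1 `*` D2) Cop Cinv) ->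
    (* S t = e^{-tC} : the C0-semigroup generated by -C *)
    C0_semigroup S -> is_generator S (D1 `*` D2) (fun f => - Cop f) ->
    forall (t : R) (n : nat), 0 < t -> (0 < n)%N ->
    forall f : X1 * X2, (D1 `*` D2) f -> pnorm (Aop f) <= 1 ->
      pnorm (iter n (split_step E1 E2 B1 B2 (t / n%:R)) f - S t f)
        <= Cst (opnorm B2) (opnorm B1) (opnorm A1inv) (opnorm A2inv) / n%:R
           * t ^+ 2 * expR (2 * t * (opnorm B1 + opnorm B2)).
Proof.
(* The 6 is the 3 of the local error times the 2 of the norm comparison; the last factor bounds
   [N f] through [|f| <= a1 + a2]. The absolute value and the [1] ensure positivity for all real
   arguments. *)
exists (fun b2 b1 a1 a2 => 1 + `|6 * (b1 + b2) * (1 + 2 * (b1 + b2) * (a1 + a2))|).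
split=> [b2 b1 a1 a2|]; first by rewrite ltr_pwDl.
move=> X1 X2 E1 E2 D1 A1 D2 A2 B1 B2 A1inv A2inv S cE1 genE1 cE2 genE2 bB1 bB2.
move=> invA1 invA2 Aop Cop _ sgS genS t n t0 n0 f Df Af.
have Af1 : `|Aop f| <= 1 := le_trans (prod_norm_le_pnorm _) Af.
set b := opnorm B1 + opnorm B2; set a := opnorm A1inv + opnorm A2inv.
have [_ _ A1K bA1] := invA1; have [_ _ A2K bA2] := invA2.
have b0 : 0 <= b by rewrite addr_ge0 ?opnorm_ge0.
have a0 : 0 <= a by rewrite addr_ge0 ?opnorm_ge0.
have fa : `|f| <= a.
  apply: prod_norm_le.
    rewrite -(A1K _ Df.1) (le_trans (le_opnorm bA1 _))//.
    rewrite (le_trans (y := opnorm A1inv))// ?lerDl ?opnorm_ge0//.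
    by rewrite ler_piMr ?opnorm_ge0// (le_trans (norm_fst_le (Aop f))).
  rewrite -(A2K _ Df.2) (le_trans (le_opnorm bA2 _))//.
  rewrite (le_trans (y := opnorm A2inv))// ?lerDr ?opnorm_ge0//.
  by rewrite ler_piMr ?opnorm_ge0// (le_trans (norm_snd_le (Aop f))).
have nR : 0 < n%:R :> R by rewrite ltr0n.
have tau0 : 0 < t / n%:R by rewrite divr_gt0.
have ntau : n%:R * (t / n%:R) = t by rewrite mulrC divfK// gt_eqF.
have := split_step_iter_error cE1 genE1 cE2 genE2 bB1 bB2 invA1 invA2 sgS genS
  n tau0 Df.
have Nf := graph_quantity_le bB1 bB2 Af1 fa.
rewrite ntau -/b => err; rewrite (le_trans (pnorm_le_prod_norm _))//.
rewrite -/b in Nf.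
set X := expR (b * t) in err; set Y := expR _.
(* The estimate comes with exponent [b * t], half of the one claimed. *)
have XY : X <= Y by rewrite ler_expR; have := mulr_ge0 b0 (ltW t0); lra.
have X0 : 0 <= X := expR_ge0 _.
set Q := n%:R * (3 * b * (t / n%:R) ^+ 2) in err.
(* Summing [n] local errors of order [(t / n) ^ 2] leaves [t ^ 2 / n]. *)
have QE : 2 * Q = 6 * b / n%:R * t ^+ 2.
  by rewrite /Q; field; rewrite gt_eqF.
have Q0 : 0 <= Q.
  apply: (mulr_ge0 (ltW nR)); apply: mulr_ge0; first by rewrite mulr_ge0.
  exact/exprn_ge0/ltW.
set K := 1 + 2 * b * a in Nf *.
have K0 : 0 <= K by rewrite addr_ge0// !mulr_ge0.
apply: (le_trans (y := 2 * (Q * Y * K))).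
  rewrite ler_wpM2l// (le_trans err)//.
  apply: ler_pM => //; first exact: mulr_ge0.
    by rewrite addr_ge0// mulr_ge0.
  exact: ler_wpM2l.
have -> : 2 * (Q * Y * K) = 6 * b * K / n%:R * t ^+ 2 * Y.
  by transitivity (2 * Q * Y * K); [ring|rewrite QE; ring].
rewrite ler_wpM2r ?expR_ge0// ler_wpM2r ?exprn_ge0 ?(ltW t0)//.
rewrite ler_wpM2r ?invr_ge0 ?(ltW nR)//.
by rewrite (le_trans (ler_norm _))// lerDr.
Qed.
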